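(* For every integer $n\ge 3$, the element $P_n$ lies in $\mathbb{Q}[x_1,\dots,x_n]$ and is an irreducible polynomial over $\mathbb{Q}$.
   Context: Let $n\ge 1$ and let $x_1,\dots,x_n$ be algebraically independent indeterminates over $\mathbb{Q}$. In a fixed algebraic closure of $\mathbb{Q}(x_1,\dots,x_n)$ fix elements $y_1,\dots,y_n$ with $y_i^2=1-x_i^2$. For indices $i_1<\dots<i_m$ define $\mathrm{EC}_m(x_{i_1},\dots,x_{i_m})=\sum_{S\subseteq\{i_1,\dots,i_m\},\ |S|\text{ even}}(-1)^{|S|/2}\prod_{j\in S}y_j\prod_{j\notin S}x_j$ (the formal expansion of $\cos(\theta_{i_1}+\dots+\theta_{i_m})$ with $x_j=\cos\theta_j$, $y_j=\sin\theta_j$); write $\mathrm{EC}_m=\mathrm{EC}_m(x_1,\dots,x_m)$. For $n\ge 2$ let $G_{n-1}$ denote the Galois group of $\mathbb{Q}(x_1,\dots,x_n,\ y_iy_j:1\le i<j\le n-1)$ over $\mathbb{Q}(x_1,\dots,x_n)$ (trivial for $n=2$). Define $P_1=x_1-1$ and, for $n\ge 2$, $P_n=\prod_{\sigma\in G_{n-1}}\bigl(x_n-\sigma(\mathrm{EC}_{n-1}(x_1,\dots,x_{n-1}))\bigr)$; thus $P_2=x_2-x_1$ and $P_3=x_1^2+x_2^2+x_3^2-2x_1x_2x_3-1$. *)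

(* Defs.v *)
From HB Require Import structures.
From mathcomp Require Import all_boot all_order all_algebra all_fingroup all_solvable all_field.
Set Implicit Arguments. Unset Strict Implicit. Unset Printing Implicit Defensive.
Import Order.TTheory GRing.Theory Num.Theory.
Local Open Scope ring_scope.

Fixpoint MP (n : nat) : idomainType :=
  match n with
  | 0 => rat
  | m.+1 => {poly (MP m)}
  end.

(* mvar n i = the variable x_{i+1} of Q[x_1,...,x_n] (0-based index i < n);
   for i >= n it is 0 (never used). *)
Fixpoint mvar (n : nat) (i : nat) : MP n :=
  match n return MP n with
  | 0 => 0
  | m.+1 => if i == m then ('X : {poly (MP m)}) else ((mvar m i)%:P : {poly (MP m)})
  end.

Definition RF (n : nat) : fieldType := {fraction (MP n)}.

(* Irreducible element of an integral domain: nonzero, nonunit, and every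
   factorization has a unit factor.  In Q[x_1,...,x_n] the units are the
   nonzero rational constants, so this is irreducibility over Q. *)
Definition irreducible_elt (R : idomainType) (p : R) : Prop :=
  p != 0 /\ p \isn't a GRing.unit /\
  forall a b : R, p = a * b -> a \is a GRing.unit \/ b \is a GRing.unit.

Definition EC (L : comPzRingType) (m : nat) (x y : nat -> L) : L :=
  \sum_(S : {set 'I_m} | ~~ odd #|S|)
     (-1) ^+ (#|S| %/ 2) * (\prod_(j in S) y (nat_of_ord j))
       * (\prod_(j in ~: S) x (nat_of_ord j)).

Definition toRF (n : nat) (p : MP n) : RF n := @FracField.tofrac (MP n) p.

(* Main.v *)
Require Import Defs.
From HB Require Import structures.
From mathcomp Require Import all_boot all_order all_algebra all_fingroup all_solvable all_field.
From mathcomp Require Import generic_quotient.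
Import Order.TTheory GRing.Theory Num.Theory.
Local Open Scope ring_scope.

(** Write A = Q[x_1, ..., x_m] with m = n - 1, K = Q(x_1, ..., x_n) and
    y_S = prod_(i in S) y_i.  No y_S with S nonempty lies in K: clearing
    denominators, r^2 = q^2 prod_(i in S) (1 - x_i^2) is impossible in signs at
    rational points where exactly one factor of the product is negative.  Every
    s in G = Gal(E / K) multiplies y_S by a sign, so Tr_{E/K} y_S = 0 for S
    even and nonempty.

    The polynomial prod_(s in G) (X - s EC_m) is a combination of the y_S, S
    even, with coefficients in A[X], and it is G-invariant; taking traces leaves
    only the coefficient at the empty S, so it equals some p in A[X].  Traces against
    y_i y_j also show that only s = 1 fixes EC_m, so p has #|G| distinct
    conjugate roots: if p = a b with a(EC_m) = 0, then a kills all of them,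
    hence deg a = deg p, and b is a constant dividing the leading coefficient 1.
    This is irreducibility in A[X] = Q[x_1, ..., x_n], without unique
    factorization. *)

Set Implicit Arguments. Unset Strict Implicit. Unset Printing Implicit Defensive.

(** * Evaluation at rational points *)

Fixpoint meval (n : nat) (a : nat -> rat) : MP n -> rat :=
  match n return MP n -> rat with
  | 0 => id
  | m.+1 => fun p => (map_poly (meval a) p).[a m]
  end.

Lemma meval_rmorph n a :
  GRing.zmod_morphism (@meval n a) * GRing.monoid_morphism (@meval n a).
Proof.
elim: n => [|n [IHa IHm]]; first by [].
pose h := HB.pack_for {rmorphism MP n -> rat} (@meval n a)
  (GRing.isZmodMorphism.Build _ _ _ IHa) (GRing.isMonoidMorphism.Build _ _ _ IHm).
split=> [p q|]; first by rewrite /= -[meval a]/(h : _ -> _) rmorphB hornerD hornerN.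
split=> [|p q] /=; rewrite -[meval a]/(h : _ -> _); first by rewrite rmorph1 hornerC.
by rewrite rmorphM hornerM.
Qed.

HB.instance Definition _ n a := GRing.isZmodMorphism.Build _ _ (@meval n a)
  (meval_rmorph n a).1.
HB.instance Definition _ n a := GRing.isMonoidMorphism.Build _ _ (@meval n a)
  (meval_rmorph n a).2.

Lemma meval_mvar n a i : (i < n)%N -> meval a (mvar n i) = a i.
Proof.
elim: n => // n IH; rewrite ltnS leq_eqVlt /=.
case: eqP => [-> _|_ /= lt_in]; first by rewrite map_polyX hornerX.
by rewrite map_polyC hornerC /= IH.
Qed.

Lemma eq_meval n a b (p : MP n) :
  (forall i, (i < n)%N -> a i = b i) -> meval a p = meval b p.
Proof.
elim: n p => //= n IH p ab; rewrite ab //.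
congr (_.[_]); apply: eq_map_poly => q; apply: IH => i lt_in.
by rewrite ab // ltnW.
Qed.

(** Induction on the variables: choose the inner values so that the leading coefficient survives,
    then the last one off the roots of the specialized polynomial. The hypothesis on [D i] says that
    no nonzero polynomial vanishes on all of it. *)
Lemma meval_neq0 n (D : nat -> rat -> Prop) (p : MP n) :
  (forall i (r : {poly rat}), r != 0 -> exists2 t, D i t & ~~ root r t) ->
  p != 0 -> exists2 a, (forall i, (i < n)%N -> D i (a i)) & meval a p != 0.
Proof.
move=> infD; elim: n p => [|n IH] p p0; first by exists (fun=> 0).
have [a Da pa] := IH _ (etrans (congr1 negb (lead_coef_eq0 p)) p0).
have q0 : map_poly (meval a) p != 0.
  by apply: contra_neq pa => q0; rewrite lead_coefE -coef_map q0 coef0.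
have [t Dt qt] := infD n _ q0.
exists (fun i => if i == n then t else a i) => [i|].
  by rewrite ltnS leq_eqVlt; case: eqP => [-> _|_ /= lt_in] //; apply: Da.
rewrite /= eqxx; congr (_ != 0): qt; congr (_.[_]); apply: eq_map_poly => r.
by apply: eq_meval => i lt_in; rewrite ltn_eqF.
Qed.

Lemma ex_nonroot_interval (lo : rat) (r : {poly rat}) : r != 0 ->
  exists2 t : rat, (lo < t < lo + 1)%R & ~~ root r t.
Proof.
(* These are [size r] distinct points, one more than the degree; the shift by 2 keeps them strictly
   below [lo + 1]. *)
move=> r0; pose rs := [seq lo + k.+2%:R^-1 | k <- iota 0 (size r)].
have Urs : uniq rs.
  rewrite map_inj_uniq ?iota_uniq // => j k /addrI/invr_inj/eqP.
  by rewrite eqr_nat !eqSS => /eqP.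
have : ~~ all (root r) rs.
  apply/negP=> /max_poly_roots/(_ Urs).
  by rewrite r0 size_map size_iota ltnn => /(_ isT).
case/allPn => _ /mapP[k _ ->] nr; exists (lo + k.+2%:R^-1) => //.
by rewrite ltrDl invr_gt0 ltr0n ltrD2l invf_lt1 ?ltr0n // ltr1n.
Qed.

Lemma prod_1_sub_sqr_not_square n (m : nat) (S : {set 'I_m}) (q r : MP n) :
  (m <= n)%N -> S != set0 -> q != 0 ->
  r ^+ 2 != q ^+ 2 * \prod_(i in S) (1 - mvar n i ^+ 2).
Proof.
move=> le_mn /set0Pn[i0 Si0] q0; apply/eqP=> Erq.
(* Coordinate [i0] is placed in (1, 2) and all others in (0, 1), so that only the factor at [i0] is
   negative. *)
pose D (i : nat) (t : rat) := ((i == i0)%:R < t < (i == i0)%:R + 1)%R.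
have D_infinite (i : nat) p := @ex_nonroot_interval (i == i0)%:R p.
have [a Da qa] := meval_neq0 (D := D) D_infinite q0.
have := congr1 (meval a) Erq.
rewrite rmorphXn rmorphM rmorphXn rmorph_prod /= => Ea.
have: meval a r ^+ 2 < 0; last by rewrite ltNge sqr_ge0.
have Eai (i : 'I_m) : meval a (1 - mvar n i ^+ 2) = 1 - a i ^+ 2.
  by rewrite rmorphB rmorph1 rmorphXn /= meval_mvar // (leq_trans (ltn_ord i)).
have Di (i : 'I_m) := Da i (leq_trans (ltn_ord i) le_mn).
rewrite Ea (eq_bigr _ (fun i _ => Eai i)).
rewrite pmulr_rlt0 ?exprn_even_gt0 // (bigD1 i0) //= pmulr_llt0.
  have /andP[] := Di i0; rewrite eqxx => a1 _.
  by rewrite subr_lt0 expr_gt1 // ltW // (lt_trans _ a1).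
apply: prodr_gt0 => i /andP[_ ii0]; rewrite subr_gt0.
have /andP[] := Di i; rewrite -val_eqE in ii0.
rewrite (negbTE ii0) add0r => a0 a1.
by rewrite expr_lt1 // ltW.
Qed.

(** * The embedding into the fraction field *)

Lemma toRF_rmorph n :
  GRing.zmod_morphism (@toRF n) * GRing.monoid_morphism (@toRF n).
Proof. split; [exact: rmorphB|split; [exact: rmorph1|exact: rmorphM]]. Qed.

HB.instance Definition _ n :=
  GRing.isZmodMorphism.Build _ _ (@toRF n) (toRF_rmorph n).1.
HB.instance Definition _ n :=
  GRing.isMonoidMorphism.Build _ _ (@toRF n) (toRF_rmorph n).2.

Lemma toRF_inj n : injective (@toRF n).
Proof. by move=> p q /eqP; rewrite tofrac_eq => /eqP. Qed.

Lemma RF_frac n (z : RF n) : exists2 q, q != 0 & exists p, z * toRF q = toRF p.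
Proof.
elim/quotW: z => x; exists (frac x).2; first exact: denom_ratioP.
exists (frac x).1; rewrite /toRF.
rewrite -[LHS]/(FracField.mul _ _) !piE; apply/eqmodP.
rewrite /= FracField.equivfE !numden_Ratio ?mulf_neq0 ?denom_ratioP ?oner_eq0 //.
by rewrite !mulr1 mulrC.
Qed.

(** * Galois action on the even products of the [y i] *)

Definition pair_products (R : pzRingType) (m : nat) (y : nat -> R) : seq R :=
  [seq y i * y j | i <- iota 0 m, j <- iota i.+1 (m - i.+1)].

Section MultiquadraticExtension.
Variables (F : fieldType) (L : splittingFieldType F) (A : idomainType).
Variables (f : {rmorphism A -> F}) (m : nat) (u : nat -> A) (y : nat -> L).
Hypothesis f_inj : injective f.
Hypothesis pchar0F : [pchar F] =i pred0.

Local Notation phi := (in_alg L \o f).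
Local Notation E := (<<1%AS & pair_products m y>>%AS).
Local Notation G := 'Gal(E / 1%AS)%g.
Local Notation yS S := (\prod_(i in S) y (nat_of_ord i)).
Local Notation ec := (EC m (fun i => phi (u i)) y).

Hypothesis y2 : forall i, (i < m)%N -> y i ^+ 2 = phi (1 - u i ^+ 2).

Lemma phi_inj : injective phi.
Proof. by move=> a b /(fmorph_inj (in_alg L))/f_inj. Qed.

Lemma phi_in1 a : phi a \in 1%VS.
Proof. by rewrite /= memvZ ?mem1v. Qed.

Lemma aend_phi (s : 'AEnd(L)) a : s (phi a) = phi a.
Proof. by rewrite /= linearZ rmorph1. Qed.

Lemma aendM_phi (s : 'AEnd(L)) a z : s (phi a * z) = phi a * s z.
Proof. by rewrite rmorphM; congr (_ * _); apply: aend_phi. Qed.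

Definition sgn (s : 'AEnd(L)) (i : nat) : bool := s (y i) != y i.

Lemma aend_y (s : 'AEnd(L)) i : (i < m)%N -> s (y i) = (-1) ^+ sgn s i * y i.
Proof.
move=> im; rewrite /sgn.
have : s (y i) ^+ 2 == y i ^+ 2 by rewrite -rmorphXn /= y2 // aend_phi.
by rewrite eqf_sqr; case: eqP => [-> _|_ /eqP->]; rewrite ?mul1r // expr1 mulN1r.
Qed.

Lemma y_pairE i j : (i < m)%N -> (j < m)%N -> y i * y j \in E.
Proof.
wlog ij : i j / (i <= j)%N => [H im jm|im jm].
  by case/orP: (leq_total i j) => ij; [|rewrite mulrC]; apply: H.
case: (eqVneq i j) => [<-|nij].
  by rewrite -expr2 y2 // (subvP (subv_adjoin_seq _ _)) ?phi_in1.
apply: seqv_sub_adjoin; apply/allpairsPdep; exists i, j.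
by rewrite !mem_iota !add0n im /= subnKC // jm ltn_neqAle nij ij.
Qed.

(** The factors are split off two at a time. *)
Lemma ySE (S : {set 'I_m}) : ~~ odd #|S| -> yS S \in E.
Proof.
rewrite cardE -big_enum /=.
have [n] := ubnP (size (enum S)); elim: n (enum S) => // n IH [|i [|j r]] //=.
  by rewrite big_nil rpred1.
rewrite negbK !big_cons mulrA => lt_rn Or.
by rewrite rpredM ?y_pairE // IH // -ltnS ltnW.
Qed.

(** Separability is characteristic 0. For normality, every automorphism of [L] sends [y i] to plus
    or minus itself, so it maps the generators into [E]. *)
Lemma galois_pairs : galois 1 E.
Proof.
apply/and3P; split; first exact: sub1v.
  apply/separableP=> z _; apply: pcharf0_separable => q.
  by rewrite -pchar0F pchar_lalg.
apply/eqfun_inP => s _.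
have: kAut 1 E s; last by case/andP=> _ /eqP.
rewrite kAut1E aimg_adjoin_seq aimg1; apply/Fadjoin_seqP.
split; first exact: sub1v.
move=> _ /mapP[_ /allpairsPdep[i [j [+ + ->]]] ->].
rewrite !mem_iota /= add0n => im /andP[ij]; rewrite subnKC // => jm.
rewrite rmorphM /= !aend_y // mulrACA rpredM ?y_pairE //.
by rewrite rpredM // rpredX // rpredN rpred1.
Qed.

(** The sign by which [s] acts on [yS S], taken in [A] so that it can be absorbed into coefficients
    from [A]. *)
Definition eps (s : 'AEnd(L)) (S : {set 'I_m}) : A :=
  \prod_(i in S) (-1) ^+ sgn s i.

Lemma aend_yS (s : 'AEnd(L)) (S : {set 'I_m}) : s (yS S) = phi (eps s S) * yS S.
Proof.
rewrite !rmorph_prod -big_split; apply: eq_bigr => i _.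
rewrite /= aend_y // rmorph_sign.
by case: sgn; rewrite ?expr0 ?expr1 ?scaleN1r ?scale1r.
Qed.

(** * Traces and combinations of the even products *)

Hypothesis y_indep : forall S : {set 'I_m}, S != set0 -> yS S \notin 1%VS.

(** The trace lies in the base field and equals [c * yS S] with [c] a sum of signs; a nonzero [c]
    would put [yS S] in the base field. *)
Lemma trace_yS (S : {set 'I_m}) : ~~ odd #|S| -> S != set0 ->
  \sum_(s in G) s (yS S) = 0.
Proof.
move=> ES S0.
have := mem_galTrace galois_pairs (ySE ES); rewrite /galTrace.
rewrite (eq_bigr _ (fun (s : gal_of E) _ => aend_yS s S)).
rewrite -mulr_suml -rmorph_sum /=; set c := f _ => H.
have [->|c0] := eqVneq c 0; first by rewrite scale0r mul0r.
case/negP: (y_indep S0); move: H; rewrite -scalerAl mul1r => H.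
by rewrite -[yS S](scalerK c0) memvZ.
Qed.

Definition symdiff (S T : {set 'I_m}) := (S :\: T) :|: (T :\: S).

Lemma odd_symdiff (S T : {set 'I_m}) :
  odd #|symdiff S T| = odd #|S| (+) odd #|T|.
Proof.
rewrite cardsU (_ : _ :&: _ = set0) ?cards0 ?subn0.
  rewrite -(cardsID T S) -(cardsID S T) !oddD setIC.
  by case: (odd #|T :&: S|); case: (odd _); case: (odd _).
by apply/setP=> i; rewrite !inE; case: (i \in S); case: (i \in T).
Qed.

Lemma mul_yS (S T : {set 'I_m}) :
  yS S * yS T = phi (\prod_(i in S :&: T) (1 - u i ^+ 2)) * yS (symdiff S T).
Proof.
rewrite rmorph_prod !(big_mkcond (fun i => i \in _)) -!big_split.
apply: eq_bigr => i _; rewrite !inE.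
case: (i \in S); case: (i \in T); rewrite /= ?mulr1 ?mul1r //.
by rewrite -expr2 y2.
Qed.

Lemma symdiff_eq0 (S T : {set 'I_m}) : (symdiff S T == set0) = (S == T).
Proof. by rewrite setU_eq0 !setD_eq0 eqEsubset. Qed.

Lemma trace_yS_mul (S T : {set 'I_m}) : ~~ odd #|S| -> ~~ odd #|T| -> S != T ->
  \sum_(s in G) s (yS S * yS T) = 0.
Proof.
move=> ES ET ST; rewrite mul_yS.
rewrite (eq_bigr _ (fun (s : gal_of E) _ => aendM_phi s _ _)) -mulr_sumr.
by rewrite trace_yS ?mulr0 ?symdiff_eq0 // odd_symdiff (negbTE ES).
Qed.

(** Coefficients come from [A], not from [F], so that the descent by traces lands in [{poly A}] with
    no integrality argument. *)
Definition even_span (Q : {poly L}) : Prop := exists C : {set 'I_m} -> {poly A},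
  Q = \sum_(S : {set 'I_m} | ~~ odd #|S|) map_poly phi (C S) * (yS S)%:P.

Lemma even_span_gen c (S : {set 'I_m}) : ~~ odd #|S| ->
  even_span (map_poly phi c * (yS S)%:P).
Proof.
move=> ES; exists (fun T => if T == S then c else 0).
rewrite (bigD1 S) //= eqxx [X in _ + X]big1 ?addr0 // => T /andP[_ /negbTE->].
by rewrite rmorph0 mul0r.
Qed.

Lemma even_span0 : even_span 0.
Proof. by exists (fun=> 0); rewrite [RHS]big1 // => S _; rewrite rmorph0 mul0r. Qed.

Lemma even_spanD P Q : even_span P -> even_span Q -> even_span (P + Q).
Proof.
move=> [C ->] [D ->]; exists (fun S => C S + D S).
by rewrite -big_split; apply: eq_bigr => S _; rewrite rmorphD mulrDl.
Qed.

Lemma even_span_sum (I : finType) (P : pred I) (Q : I -> {poly L}) :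
  (forall i, P i -> even_span (Q i)) -> even_span (\sum_(i | P i) Q i).
Proof. by apply: big_ind; [apply: even_span0|apply: even_spanD]. Qed.

Lemma even_spanM P Q : even_span P -> even_span Q -> even_span (P * Q).
Proof.
move=> [C ->] [D ->]; rewrite mulr_suml; apply: even_span_sum => S ES.
rewrite mulr_sumr; apply: even_span_sum => T ET.
rewrite mulrACA -polyCM mul_yS polyCM -(map_polyC phi) mulrA -!rmorphM.
by apply: even_span_gen; rewrite odd_symdiff (negbTE ES).
Qed.

Lemma even_span_phi c : even_span (map_poly phi c).
Proof.
have := @even_span_gen c set0; rewrite cards0 big_set0 mulr1; exact.
Qed.

(** * Conjugates of EC and its trivial stabilizer *)

Definition EC_coef (S : {set 'I_m}) : A :=
  (-1) ^+ (#|S| %/ 2) * \prod_(i in ~: S) u i.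

Lemma EC_sum : ec = \sum_(S : {set 'I_m} | ~~ odd #|S|) phi (EC_coef S) * yS S.
Proof.
apply: eq_bigr => S _; rewrite [in RHS]rmorphM rmorphXn rmorphN1 rmorph_prod.
by rewrite mulrAC.
Qed.

Lemma aend_EC (s : 'AEnd(L)) :
  s ec = \sum_(S : {set 'I_m} | ~~ odd #|S|) phi (EC_coef S * eps s S) * yS S.
Proof.
rewrite EC_sum [LHS]rmorph_sum; apply: eq_bigr => S _.
by rewrite [LHS]aendM_phi aend_yS mulrA -rmorphM.
Qed.

Lemma EC_in_E : ec \in E.
Proof.
rewrite EC_sum; apply: rpred_sum => S ES; rewrite rpredM ?ySE //.
by rewrite (subvP (subv_adjoin_seq _ _)) ?phi_in1.
Qed.

Hypothesis u_neq0 : forall i, (i < m)%N -> u i != 0.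

Lemma pchar0L : [pchar L] =i pred0.
Proof. by move=> p; rewrite -pchar0F pchar_lalg. Qed.

Lemma natG_neq0 : #|G|%:R != 0 :> L.
Proof. by have /pcharf0P-> := pchar0L; rewrite -lt0n cardG_gt0. Qed.

(** Multiplying [s ec - ec = 0] by [yS T] and taking the trace isolates the coefficient at [T], by
    orthogonality of distinct even products. *)
Lemma aend_id_EC_eps (s : 'AEnd(L)) (T : {set 'I_m}) : ~~ odd #|T| ->
  s ec = ec -> phi (eps s T) = 1.
Proof.
move=> ET sEC.
have yT0 : yS T != 0.
  apply/eqP => yT; have T0 : T != set0.
    by apply: contra_eq_neq yT => ->; rewrite big_set0 oner_neq0.
  by case/negP: (y_indep T0); rewrite yT mem0v.
pose k S : A := EC_coef S * eps s S - EC_coef S.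
have ES0 : \sum_(S : {set 'I_m} | ~~ odd #|S|) phi (k S) * (yS S * yS T) = 0.
  transitivity ((s ec - ec) * yS T); last by rewrite sEC subrr mul0r.
  rewrite aend_EC [X in _ - X]EC_sum -sumrB mulr_suml; apply: eq_bigr => S _.
  by rewrite -mulrBl mulrA rmorphB.
have: \sum_(t in G) t (\sum_(S : {set 'I_m} | ~~ odd #|S|)
                          phi (k S) * (yS S * yS T)) = 0.
  by rewrite ES0 big1 // => t _; rewrite rmorph0.
rewrite (eq_bigr (fun t : gal_of E => \sum_(S : {set 'I_m} | ~~ odd #|S|)
    phi (k S) * t (yS S * yS T))); last first.
  move=> t _; rewrite [LHS]rmorph_sum; apply: eq_bigr => S _; exact: aendM_phi.
rewrite exchange_big (bigD1 T) //= [X in _ + X]big1 ?addr0; last first.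
  by move=> S /andP[ES ST]; rewrite -mulr_sumr trace_yS_mul ?mulr0.
rewrite -mulr_sumr (eq_bigr (fun=> yS T * yS T)); last first.
  move=> t _; rewrite -[LHS]/(t (yS T * yS T)) mul_yS (_ : symdiff T T = set0).
    by rewrite big_set0 mulr1 (aend_phi t).
  by apply/eqP; rewrite symdiff_eq0.
rewrite sumr_const -mulr_natr => /eqP.
rewrite !mulf_eq0 (negbTE natG_neq0) (negbTE yT0) !orbF => /eqP kT.
have: phi (k T) = phi 0 by rewrite rmorph0.
(* [EC_coef T] cancels: it is a sign times a product of nonzero [u i]. *)
move/phi_inj/eqP; rewrite /k subr_eq0 -[X in _ == X]mulr1 => /eqP/mulfI->.
  by rewrite rmorph1 scale1r.
rewrite mulf_neq0 ?signr_eq0 //; apply/prodf_neq0 => i _; exact: u_neq0.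
Qed.

Lemma gal_id_EC (s : gal_of E) : s \in G -> s ec = ec -> s = 1%g.
Proof.
move=> sG sEC; apply/eqP/gal_eqP => z Ez; rewrite gal_id.
suff /subvP/(_ z Ez) : (E <= fixedField [set s])%VS.
  by case/mem_fixedFieldP => _; apply; rewrite inE.
apply/Fadjoin_seqP; split; first exact: sub1v.
move=> w Yw; have Ew : w \in E by apply: seqv_sub_adjoin.
apply/fixedFieldP => // t; rewrite inE => /eqP->.
case/allpairsPdep: Yw => i [j [+ + ->]].
rewrite !mem_iota /= add0n => im /andP[ij]; rewrite subnKC // => jm.
(* A two-element [T] makes [yS T] a generator of [E], and the sign of [s] on it is 1. *)
pose T := [set Ordinal im; Ordinal jm].
have ij' : Ordinal im != Ordinal jm by rewrite -val_eqE /= ltn_eqF.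
have yT : yS T = y i * y j by rewrite big_setU1 ?inE // big_set1.
by rewrite -yT [LHS]aend_yS aend_id_EC_eps ?mul1r // cards2 ij'.
Qed.

Lemma gal_EC_inj : {in G &, injective (fun s : gal_of E => s ec)}.
Proof.
move=> s t sG tG /= st; apply/eqP; rewrite eq_mulgV1; apply/eqP.
apply: gal_id_EC; first by rewrite groupM ?groupV.
by rewrite galM ?EC_in_E // st -galM ?EC_in_E // mulgV gal_id.
Qed.

(** * The product over the conjugates and its irreducibility *)

Definition conj_poly : {poly L} := \prod_(s in G) ('X - (s ec)%:P).

Lemma even_span_conj_poly : even_span conj_poly.
Proof.
have span1 : even_span 1 by have := even_span_phi 1; rewrite rmorph1.
rewrite /conj_poly; apply: (big_ind even_span) => // [|s _]; first exact: even_spanM.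
rewrite aend_EC -(map_polyX phi) raddf_sum -sumrN.
apply: even_spanD; first exact: even_span_phi.
apply: even_span_sum => S ES.
rewrite -[X in - X]/(polyC _) polyCM -mulNr -(map_polyC phi) -rmorphN.
exact: even_span_gen.
Qed.

Lemma map_conj_poly (t : gal_of E) : t \in G -> map_poly t conj_poly = conj_poly.
Proof.
move=> tG; rewrite /conj_poly rmorph_prod [RHS](reindex_inj (mulIg t)) /=.
apply: eq_big => [s|s _]; first by rewrite groupMr.
rewrite rmorphB /= map_polyX map_polyC /= galM //; exact: EC_in_E.
Qed.

Lemma conj_poly_descent : exists p : {poly A}, conj_poly = map_poly phi p.
Proof.
have [C QE] := even_span_conj_poly; exists (C set0).
(* By invariance, [#|G|] times [conj_poly] is the sum of its images under [G], in which only the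
   term at [set0] survives. *)
have G0 : #|G|%:R%:P != 0 :> {poly L} by rewrite polyC_eq0 natG_neq0.
apply: (mulIf G0); rewrite polyC_natr.
rewrite mulr_natr -sumr_const -(eq_bigr _ map_conj_poly) QE.
rewrite (eq_bigr (fun t : gal_of E => \sum_(S : {set 'I_m} | ~~ odd #|S|)
    map_poly phi (C S) * (t (yS S))%:P)); last first.
  move=> t _; rewrite rmorph_sum; apply: eq_bigr => S _.
  rewrite rmorphM /= map_polyC; congr (_ * _); rewrite -map_poly_comp.
  by apply: eq_map_poly => a; apply: (aend_phi t).
rewrite exchange_big (bigD1 set0) ?cards0 //= [X in _ + X]big1 => [|S /andP[ES S0]].
  rewrite addr0 -mulr_sumr -raddf_sum big_set0 /= (eq_bigr (fun=> 1)) => [|t _].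
    by rewrite sumr_const polyCMn.
  exact: rmorph1.
by rewrite -mulr_sumr -raddf_sum trace_yS ?mulr0.
Qed.

Lemma conj_poly_roots (q : {poly A}) : q != 0 ->
  root (map_poly phi q) ec -> (#|G| < size q)%N.
Proof.
move=> q0 qEC.
have := @max_poly_roots _ (map_poly phi q) [seq s ec | s : gal_of E in G].
rewrite size_image size_map_inj_poly ?rmorph0 //; last exact: phi_inj.
apply.
- rewrite -(rmorph0 (map_poly phi)).
  by rewrite (inj_eq (map_inj_poly phi_inj (rmorph0 _))).
- apply/allP=> _ /imageP[s _ ->]; rewrite -(fmorph_root s) in qEC.
  congr (root _ _): qEC; rewrite -map_poly_comp.
  by apply: eq_map_poly => a; apply: (aend_phi s).
- rewrite map_inj_in_uniq ?enum_uniq // => s t; rewrite !mem_enum.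
  exact: gal_EC_inj.
Qed.

Theorem conj_poly_irreducible :
  exists p : {poly A}, conj_poly = map_poly phi p /\ irreducible_elt p.
Proof.
have [p pE] := conj_poly_descent; exists p; split=> //.
have sp : size p = #|G|.+1.
  rewrite -(size_map_inj_poly phi_inj (rmorph0 _)) -pE /conj_poly -big_enum.
  by rewrite size_prod_XsubC -cardE.
have lp : lead_coef p = 1.
  apply: phi_inj; rewrite rmorph1 -(lead_coef_map_inj phi_inj (rmorph0 _)) -pE.
  by apply/eqP/monic_prod => s _; apply: monicXsubC.
have p0 : p != 0 by rewrite -size_poly_eq0 sp.
split=> //; split; first by rewrite poly_unitE sp eqSS -leqn0 leqNgt cardG_gt0.
have key (a b : {poly A}) : p = a * b -> root (map_poly phi a) ec ->
    b \is a GRing.unit.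
  move=> pab aEC.
  have [a0 b0] : a != 0 /\ b != 0.
    by apply/andP; rewrite -negb_or -mulf_eq0 -pab.
  have := conj_poly_roots a0 aEC; have := sp; rewrite pab size_mul // => sab lta.
  have sb : size b = 1%N.
    (* Sizes are degrees plus one: [size a + size b - 1 = #|G| + 1] and [size a > #|G|] leave
       [size b] at most 1. *)
    apply/eqP; rewrite eqn_leq lt0n size_poly_eq0 b0 andbT.
    rewrite -(leq_add2l (size a)) addn1 -[(_ + _)%N]prednK ?sab ?ltnS //.
    by rewrite addn_gt0 size_poly_gt0 a0.
  rewrite poly_unitE sb eqxx /=; apply/unitrPr; exists (lead_coef a).
  have -> : b`_0 = lead_coef b by rewrite lead_coefE sb.
  by rewrite mulrC -lead_coefM -pab.
move=> a b pab.
have : root (map_poly phi p) ec.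
  rewrite -pE rootE /conj_poly (bigD1 1%g) //= hornerM hornerXsubC gal_id subrr.
  by rewrite mul0r.
rewrite pab rmorphM rootM => /orP[aEC|bEC]; [right|left].
  exact: key pab aEC.
by apply: key bEC; rewrite mulrC.
Qed.
End MultiquadraticExtension.

(** * Specialization to rational functions over Q *)

Lemma pchar_RF n : [pchar (RF n)] =i pred0.
Proof.
apply/pcharf0P => k; apply/eqP/eqP => [|->//].
rewrite -(rmorph_nat (@toRF n)) -(rmorph0 (@toRF n)).
move=> /toRF_inj/(congr1 (@meval n (fun=> 0))).
by rewrite rmorph_nat rmorph0 => /eqP; rewrite pnatr_eq0 => /eqP.
Qed.

Lemma mvar_neq0 n i : (i < n)%N -> mvar n i != 0.
Proof.
move=> lt_in; apply/eqP => /(congr1 (meval (fun=> 1))).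
by rewrite meval_mvar // rmorph0 => /eqP; rewrite oner_eq0.
Qed.

Lemma eq_EC (R : comPzRingType) m (x x' y : nat -> R) :
  (forall i, (i < m)%N -> x i = x' i) -> EC m x y = EC m x' y.
Proof.
move=> xx'; apply: eq_bigr => S _; congr (_ * _).
by apply: eq_bigr => i _; apply: xx'.
Qed.

(* L is any (finite, normal) extension of K = Q(x_1,...,x_n) containing
   elements y_1..y_n with y_i^2 = 1 - x_i^2.  E = K(y_i y_j : i<j<=n-1),
   G_{n-1} = Gal(E/K), P_n = prod_{s in G_{n-1}} (x_n - s(EC_{n-1})). *)
Theorem theorem3 (n : nat) (Hn : (3 <= n)%N)
    (L : splittingFieldType (RF n)) (y : nat -> L)
    (Hy : forall i : nat, (i < n)%N ->
            y i ^+ 2 = 1 - (toRF (mvar n i))%:A ^+ 2) :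
  let x : nat -> L := fun i => (toRF (mvar n i))%:A in
  let yy : seq L := [seq y i * y j |
               i <- iota 0 n.-1, j <- iota i.+1 (n.-1 - i.+1)] in
  let E : {subfield L} := <<1%AS & yy>>%AS in
  let Pn : L := \prod_(s in 'Gal(E / 1%AS)%g) (x n.-1 - s (EC n.-1 x y)) in
  exists p : MP n, Pn = (toRF p)%:A /\ irreducible_elt p.
Proof.
case: n Hn L y Hy => // m Hm L y Hy x yy E Pn; rewrite [_.-1]/= in x yy E Pn *.
(* The first [m] variables give [A], seen as constants in the last one; the base field still
   contains all [m.+1] variables. *)
pose f : {rmorphism MP m -> RF m.+1} := (@toRF m.+1 \o (polyC : MP m -> MP m.+1)).
pose psi : {rmorphism MP m.+1 -> L} := (in_alg L \o @toRF m.+1).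
pose phi : {rmorphism MP m -> L} := (in_alg L \o f).
have f_inj : injective f by move=> a b /toRF_inj/polyC_inj.
have mvarE i : (i < m)%N -> mvar m.+1 i = (mvar m i)%:P.
  by move=> lt_im; rewrite /= ltn_eqF.
have y2' i : (i < m)%N -> y i ^+ 2 = psi (1 - mvar m.+1 i ^+ 2).
  move=> lt_im; rewrite (Hy i (leqW lt_im)).
  rewrite [RHS]rmorphB [in RHS]rmorph1 [in RHS]rmorphXn; reflexivity.
have y2 i : (i < m)%N -> y i ^+ 2 = phi (1 - mvar m i ^+ 2).
  move=> lt_im; rewrite (y2' i lt_im) (mvarE i lt_im).
  rewrite -[RHS]/(psi (polyC _)) (rmorphB polyC) (rmorph1 polyC) (rmorphXn polyC).
  reflexivity.
have y_indep (S : {set 'I_m}) : S != set0 -> \prod_(i in S) y i \notin 1%VS.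
  move=> S0; apply/negP => /vlineP[k Ek].
  (* If the product were [k] in the base field, writing [k = r / q] and squaring would give the
     excluded identity. *)
  have [q q0 [r Er]] := RF_frac k.
  have /eqP[] := prod_1_sub_sqr_not_square r (leqnSn m) S0 q0.
  apply: (@toRF_inj m.+1); apply: (fmorph_inj (in_alg L)).
  have psi_r : psi r = (\prod_(i in S) y i) * psi q.
    by rewrite Ek -[psi r]/((toRF r)%:A) -Er -scalerAl mul1r scalerA.
  rewrite -[LHS]/(psi _) -[RHS]/(psi _).
  rewrite rmorphXn psi_r exprMn rmorphM rmorphXn mulrC; congr (_ * _).
  rewrite rmorph_prod -prodrXl; apply: eq_bigr => i _; exact: y2'.
have [p [pE p_irr]] := conj_poly_irreducible
  f_inj (@pchar_RF m.+1) y2 y_indep (@mvar_neq0 m).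
exists p; split; last exact: p_irr.
(* [Pn] is [conj_poly] evaluated at the last variable. Since [MP m.+1] is [{poly (MP m)}],
   substituting ['X] for the formal variable returns [p] itself. *)
transitivity (map_poly phi p).[psi 'X]; last first.
  rewrite -[RHS]/(psi p) -[in RHS](comp_polyXr p) -(horner_map psi).
  rewrite -(map_poly_comp psi polyC).
  reflexivity.
rewrite -pE horner_prod; apply: eq_bigr => s _.
rewrite hornerXsubC; congr (_ - s _); first by rewrite /x /= eqxx.
by apply: eq_EC => i lt_im; rewrite /x (mvarE i lt_im).
Qed.
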